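(* Let $n\ge 1$, let $B=(b_{ij})$ be a real $n\times n$ matrix with $b_{ij}\ge 0$ for all $i,j$ and $b_{ii}=0$, let $c\in\mathbb{R}^n$ and $X\subseteq\{0,1\}^n$. Let $\overline{X}$ satisfy $X\subseteq\overline{X}\subseteq[0,1]^n$, and let $u_i=\max\{\sum_{j\neq i}b_{ij}x_j : x\in\overline{X}\}$, $i=1,\dots,n$. For $\lambda\in\{0,1\}^n$ put $\alpha_i^{(\lambda)}=\sum_{j\neq i}\lambda_jb_{ji}+\lambda_iu_i$ ($i=1,\dots,n$) and $\beta^{(\lambda)}=\sum_{i=1}^n\lambda_iu_i$. Consider (PL$_1$): minimize $\sum_{i=1}^n (y_i+c_ix_i)$ over $(x,y)\in X\times\mathbb{R}^n$ subject to $y_i\ge \sum_{j\neq i}b_{ij}x_j+u_ix_i-u_i$ and $y_i\ge 0$ for $i=1,\dots,n$; (DL$_1$): minimize $z+\sum_{i=1}^n c_ix_i$ over $(z,x)\in\mathbb{R}\times X$ subject to $z\ge\sum_{i=1}^n\alpha_i^{(\lambda)}x_i-\beta^{(\lambda)}$ for every $\lambda\in\{0,1\}^n$. Then (PL$_1$) and (DL$_1$) are equivalent in the sense that for each optimal solution to one problem, there exists an optimal solution to the other problem having the same optimal objective value.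
   Context: (DL$_1$) is the Balas–Mazzola linearization of the quadratic 0-1 program $\min\{x^TBx+c^Tx: x\in X\}$. The set $\overline{X}$ is a relaxation of $X$ assumed chosen so that the maxima defining $u_i$ are attained. *)

(* Defs.v *)
From mathcomp Require Import all_boot all_order all_algebra.
From mathcomp Require Import classical_sets reals.

Set Implicit Arguments.
Unset Strict Implicit.
Unset Printing Implicit Defensive.

Import Order.TTheory GRing.Theory Num.Theory.
Local Open Scope ring_scope.
Local Open Scope classical_set_scope.

Definition binary (R : realType) (n : nat) : set 'cV[R]_n :=
  [set x | forall i, x i 0 = 0 \/ x i 0 = 1].
Arguments binary : clear implicits.

Definition unit_box (R : realType) (n : nat) : set 'cV[R]_n :=
  [set x | forall i, 0 <= x i 0 <= 1].
Arguments unit_box : clear implicits.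

(* The maximum of A is attained and equal to m. *)
Definition is_max (R : realType) (A : set R) (m : R) : Prop :=
  A m /\ ubound A m.

(* s is an optimal solution of: minimize f over F. *)
Definition optimal (R : realType) (T : Type) (F : set T) (f : T -> R) (s : T)
  : Prop := F s /\ forall t, F t -> f s <= f t.

Section Linearizations.
Variables (R : realType) (n : nat).
Implicit Types (B : 'M[R]_n) (c u l x : 'cV[R]_n) (X : set 'cV[R]_n).

Definition offdiag_row B x (i : 'I_n) : R := \sum_(j | j != i) B i j * x j 0.

Definition alpha B u l (i : 'I_n) : R :=
  (\sum_(j | j != i) l j 0 * B j i) + l i 0 * u i 0.

Definition beta u l : R := \sum_i l i 0 * u i 0.

(* Points of PL are pairs (x, y). *)
Definition PL_feasible B u X : set ('cV[R]_n * 'cV[R]_n) :=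
  [set p : 'cV[R]_n * 'cV[R]_n | X p.1 /\ forall i,
     offdiag_row B p.1 i + u i 0 * p.1 i 0 - u i 0 <= p.2 i 0 /\ 0 <= p.2 i 0].

Definition PL_objective c (p : 'cV[R]_n * 'cV[R]_n) : R :=
  \sum_i (p.2 i 0 + c i 0 * p.1 i 0).

(* Points of DL are pairs (z, x). *)
Definition DL_feasible B u X : set (R * 'cV[R]_n) :=
  [set q : R * 'cV[R]_n | X q.2 /\ forall l, binary R n l ->
     (\sum_i alpha B u l i * q.2 i 0) - beta u l <= q.1].

Definition DL_objective c (q : R * 'cV[R]_n) : R :=
  q.1 + \sum_i c i 0 * q.2 i 0.

End Linearizations.

(* Main.v *)
(* Exchanging the order of summation turns the DL constraint indexed by l into
   z >= \sum_i l_i g_i(x), where y_i >= g_i(x) and y_i >= 0 are the PL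
   constraints.  Maximizing over binary l, both problems minimize
   \sum_i max(g_i(x), 0) + c^T x over X. *)
Require Import Defs.
From mathcomp Require Import all_boot all_order all_algebra.
From mathcomp Require Import classical_sets reals.

Set Implicit Arguments.
Unset Strict Implicit.
Unset Printing Implicit Defensive.

Import Order.TTheory GRing.Theory Num.Theory.
Local Open Scope ring_scope.
Local Open Scope classical_set_scope.

(** By the second domination, [f s] bounds [g] from below on [G]; by the first, some point of [G]
    has value at most [f s], so it attains this bound. *)
Lemma optimal_transfer (R : realType) (S T : Type) (F : set S) (G : set T)
    (f : S -> R) (g : T -> R) :
  (forall s, F s -> exists2 t, G t & g t <= f s) ->
  (forall t, G t -> exists2 s, F s & f s <= g t) ->
  forall s, optimal F f s -> exists t, optimal G g t /\ g t = f s.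
Proof.
move=> FG GF s [Fs s_min].
have lb t : G t -> f s <= g t.
  by case/GF => s' /s_min + s't; move/le_trans; apply.
have [t Gt ts] := FG s Fs.
exists t; split; last by apply/le_anti; rewrite ts lb.
by split=> // t' /lb; apply: le_trans.
Qed.

Section Linearizations.
Variables (R : realType) (n : nat) (B : 'M[R]_n) (u c : 'cV[R]_n).
Variable X : set 'cV[R]_n.
Implicit Types (l x : 'cV[R]_n).

Definition slack x i : R := offdiag_row B x i + u i 0 * x i 0 - u i 0.

Lemma sum_alpha_beta l x :
  \sum_i alpha B u l i * x i 0 - beta u l = \sum_i l i 0 * slack x i.
Proof.
rewrite /beta /alpha /slack /offdiag_row.
under eq_bigr do rewrite mulrDl mulr_suml.
under [RHS]eq_bigr do rewrite mulrBr mulrDr mulr_sumr mulrA.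
rewrite sumrB !big_split /=; congr (_ + _ - _).
(* The inner range [j != i] depends on the outer index, but the condition is symmetric and survives
   the exchange. *)
rewrite (exchange_big_dep predT) //=; apply: eq_bigr => i _.
by apply: eq_big => [j | j _]; rewrite 1?eq_sym ?mulrA.
Qed.

(** Taking [z] as the sum of the [y i 0] keeps the objective. For each [i], a binary [l] selects one
    of the two lower bounds on [y i 0]. *)
Lemma PL_to_DL p : PL_feasible B u X p ->
  exists2 q, DL_feasible B u X q & DL_objective c q <= PL_objective c p.
Proof.
case: p => x y [/= Xx y_ge]; exists (\sum_i y i 0, x); last first.
  by rewrite /DL_objective /PL_objective big_split.
split=> //= l l01; rewrite sum_alpha_beta; apply: ler_sum => i _.
by have [y_ge_slack y_ge0] := y_ge i; case: (l01 i) => ->; rewrite ?mul0r ?mul1r.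
Qed.

Lemma DL_to_PL q : DL_feasible B u X q ->
  exists2 p, PL_feasible B u X p & PL_objective c p <= DL_objective c q.
Proof.
case: q => z x [/= Xx z_ge].
(* This is the least [y] feasible for [x]. *)
exists (x, \col_i Num.max (slack x i) 0).
  by split=> //= i; rewrite mxE !le_max !lexx orbT.
rewrite /PL_objective /DL_objective big_split lerD2r /=.
(* The tightest constraint on [z]: [l] keeps exactly the nonnegative terms, so its right-hand side
   is the sum of the maxima. *)
pose l : 'cV[R]_n := \col_i (0 <= slack x i)%R%:R.
have l01 : binary R n l.
  by move=> i; rewrite mxE; case: (0 <= _); [right | left].
apply: le_trans (z_ge l l01); rewrite sum_alpha_beta; apply: ler_sum => i _.
by rewrite !mxE; case: (leP 0 (slack x i)); rewrite ?mul1r ?mul0r.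
Qed.

End Linearizations.

Theorem theorem2 (R : realType) (n : nat) (n_ge1 : (1 <= n)%N)
    (B : 'M[R]_n) (B_ge0 : forall i j, 0 <= B i j)
    (B_diag : forall i, B i i = 0)
    (c : 'cV[R]_n) (X Xbar : set 'cV[R]_n)
    (X_binary : X `<=` binary R n)
    (X_sub_Xbar : X `<=` Xbar) (Xbar_box : Xbar `<=` unit_box R n)
    (u : 'cV[R]_n)
    (u_max : forall i,
       is_max [set offdiag_row B x i | x in Xbar] (u i 0)) :
  (forall p, optimal (PL_feasible B u X) (PL_objective c) p ->
     exists q, optimal (DL_feasible B u X) (DL_objective c) q /\
       DL_objective c q = PL_objective c p) /\
  (forall q, optimal (DL_feasible B u X) (DL_objective c) q ->
     exists p, optimal (PL_feasible B u X) (PL_objective c) p /\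
       PL_objective c p = DL_objective c q).
Proof.
(* Each direction needs both dominations, with the roles of the problems swapped. *)
by split; apply: optimal_transfer => ?; [exact: PL_to_DL | exact: DL_to_PL
                                        | exact: DL_to_PL | exact: PL_to_DL].
Qed.
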